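(* Let $r,q$ be natural numbers with $r\le q+1$, $a=(a_1,\dots,a_r)\in\mathbb{C}^{r}$, $k=(k_1,\dots,k_r),\,p=(p_1,\dots,p_r)\in(\mathbb{R}^{+})^{r}$, $s=(s_1,\dots,s_q),\,t=(t_1,\dots,t_q)\in(\mathbb{R}^{+})^{q}$, and $b=(b_1,\dots,b_q)\in\mathbb{C}^{q}$. Assume that no $\frac{b_j}{s_j}$ is a negative integer or zero and that no two of the $\frac{b_j}{s_j}$ differ by an integer or zero. Put $\theta=x\frac{d}{dx}$, $A=\dfrac{\prod_{i=1}^{r}p_i}{\prod_{j=1}^{q}t_j}$ and $W=F(a,p,k;b,t,s;x)$. Then, for $x$ in the open disc of convergence of the series defining $W$, $$\left[\theta\prod_{j=1}^{q}\left(\theta+\frac{b_j}{s_j}-1\right)-A\,x\prod_{i=1}^{r}\left(\theta+\frac{a_i}{k_i}\right)\right]W=0.$$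
   Context: For positive reals $p,k$ and $z\in\mathbb{C}$, the p-k Pochhammer symbol is ${}_{p}(z)_{n,k}=\left(\frac{zp}{k}\right)\left(\frac{zp}{k}+p\right)\cdots\left(\frac{zp}{k}+(n-1)p\right)$, with ${}_{p}(z)_{0,k}=1$. The p-k hypergeometric function is $$F(a,p,k;b,t,s;x)=\sum_{n=0}^{\infty}\frac{\prod_{i=1}^{r}{}_{p_i}(a_i)_{n,k_i}}{\prod_{j=1}^{q}{}_{t_j}(b_j)_{n,s_j}}\,\frac{x^{n}}{n!},$$ whose series converges for all $x\in\mathbb{C}$ if $r\le q$, and for $|x|<\left|\frac{t_1\cdots t_q}{p_1\cdots p_r}\right|$ if $r=q+1$. *)

(* Defs.v *)
From mathcomp Require Import all_boot.
From Stdlib Require Import Reals.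
From Coquelicot Require Import Coquelicot.

Set Implicit Arguments.
Unset Strict Implicit.
Unset Printing Implicit Defensive.

Local Open Scope C_scope.

Notation "\Cprod_ ( i < n ) F" :=
  (\big[Cmult/RtoC 1%R]_(i < n) F%C)
  (at level 36, F at level 36, i, n at level 50,
   format "'[' \Cprod_ ( i  <  n ) '/  '  F ']'") : C_scope.

Definition pk_pochhammer (p k : R) (z : C) (n : nat) : C :=
  \Cprod_(m < n) (z * p / k + INR m * p).

Section Hypergeometric.

Variables (r q : nat).
Variables (a : 'I_r -> C) (p k : 'I_r -> R).
Variables (b : 'I_q -> C) (t s : 'I_q -> R).

Definition pk_coef (n : nat) : C :=
  (\Cprod_(i < r) pk_pochhammer (p i) (k i) (a i) n)
  / (\Cprod_(j < q) pk_pochhammer (t j) (s j) (b j) n)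
  / INR n`!.

(* [iota P] is the unique point satisfying [P], when there is one; outside the
   set of convergence the value is irrelevant. *)
Definition pk_hypergeometric (x : C) : C :=
  @iota C_CompleteNormedModule
    (@is_pseries C_AbsRing C_NormedModule pk_coef x).

(* [CV_radius] is stated for real coefficients; the radius of convergence only
   depends on their moduli. *)
Definition pk_disc (x : C) : Prop :=
  Rbar_lt (Cmod x) (CV_radius (fun n => Cmod (pk_coef n))).

End Hypergeometric.

(* [C_derive] takes the limit of the difference quotient along the real
   direction only; it is the complex derivative wherever that exists
   ([C_derive_correct]), hence everywhere in the disc of convergence of a power
   series. *)
Definition theta (f : C -> C) : C -> C := fun x => x * C_derive f x.

Definition theta_plus (c : C) (f : C -> C) : C -> C :=
  fun x => theta f x + c * f x.

(* The factors of a product of operators are composed, the one of index 0 being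
   applied last; on holomorphic functions the order is immaterial. *)
Definition theta_prod (n : nat) (c : 'I_n -> C) : (C -> C) -> (C -> C) :=
  \big[@ssrfun.comp (C -> C) (C -> C) (C -> C) / @id (C -> C)]_(i < n)
    theta_plus (c i).

(* Main.v *)
(** The operators [theta + c] act on a convergent power series [sum u_n x^n] by
    multiplying [u_n] by [n + c], without shrinking the disc of convergence.
    The differential equation is therefore equivalent to the two-term
    recurrence
      [(n+1) prod_j (n + b_j/s_j) c_(n+1) = A prod_i (n + a_i/k_i) c_n],
    which holds because [z p / k + n p = p (z / k + n)]. *)
Require Import Defs.
From HB Require Import structures.
From mathcomp Require Import all_boot.
From Stdlib Require Import Reals Lra.
From Coquelicot Require Import Coquelicot.

Local Open Scope C_scope.

(** * Products of complex numbers *)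

HB.instance Definition _ :=
  Monoid.isComLaw.Build C (RtoC 1) Cmult Cmult_assoc Cmult_comm Cmult_1_l.

Lemma Cprod_neq0 (n : nat) (F : 'I_n -> C) :
  (forall i, F i <> 0) -> \Cprod_(i < n) F i <> 0.
Proof.
move=> F_neq0; apply: (big_ind (fun z : C => z <> 0)) => //.
- exact: C1_nz.
- exact: Cmult_neq_0.
Qed.

(** * Series of complex numbers *)

(** By comparison, every point of absolute convergence for [b] is one for [a]; the radii are the
    least upper bounds of these two nested sets. *)
Lemma CV_radius_le (a b : nat -> R) :
  (forall n, Rabs (a n) <= Rabs (b n))%R ->
  Rbar_le (CV_radius b) (CV_radius a).
Proof.
move=> le_ab; rewrite /CV_radius.
apply: is_lub_Rbar_subset (Lub_Rbar_correct _) (Lub_Rbar_correct _) => x.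
apply: (@ex_series_le R_AbsRing R_CompleteNormedModule) => n.
rewrite /norm /= /abs /= Rabs_Rabsolu !Rabs_mult.
by apply: Rmult_le_compat_r => //; apply: Rabs_pos.
Qed.

(** The coefficients [n * a n] are those of the derivative shifted by one place, and neither
    operation changes the radius. *)
Lemma CV_radius_scal_INR (a : nat -> R) :
  CV_radius (fun n => INR n * a n)%R = CV_radius a.
Proof.
rewrite -[RHS]CV_radius_derive -[RHS]CV_radius_incr_1.
by apply: CV_radius_ext => -[|n]; rewrite /PS_incr_1 /PS_derive /= ?Rmult_0_l.
Qed.

Definition Cradius (u : nat -> C) : Rbar := CV_radius (fun n => Cmod (u n)).

(** Follows from [|n + c| <= n + (1 + |c|)]; the added 1 keeps the scalar nonzero when [c = 0], as
    [CV_radius_scal] requires. *)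
Lemma Cradius_scal_shift (c : C) (u : nat -> C) :
  Rbar_le (Cradius u) (Cradius (fun n => (INR n + c) * u n)).
Proof.
pose a n := Cmod (u n).
have c_neq0 : (1 + Cmod c <> 0)%R by move: (Cmod_ge_0 c); lra.
apply: (Rbar_le_trans _ (CV_radius
  (PS_plus (fun n => INR n * a n)%R (PS_scal (1 + Cmod c)%R a)))).
  apply: Rbar_le_trans (CV_radius_plus _ _).
  rewrite CV_radius_scal_INR CV_radius_scal //.
  rewrite /Cradius -/a; case: (CV_radius a) => [y||] //=.
  by rewrite Rmin_left; lra.
apply: CV_radius_le => n.
rewrite /PS_plus /PS_scal /plus /scal /= /mult /= /a.
have u_ge0 := Cmod_ge_0 (u n); have n_ge0 := pos_INR n.
have c_ge0 := Cmod_ge_0 c.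
rewrite (Rabs_pos_eq (Cmod _)); last exact: Cmod_ge_0.
apply: Rle_trans (Rle_abs _).
rewrite Cmod_mult -Rmult_plus_distr_r.
apply: Rmult_le_compat_r => //.
apply: Rle_trans (Cmod_triangle _ _) _.
by rewrite Cmod_R Rabs_pos_eq //; lra.
Qed.

Definition Cseries (v : nat -> C) (l : C) : Prop :=
  @is_series C_AbsRing C_NormedModule v l.

Lemma Cseries_unique (v : nat -> C) (l1 l2 : C) :
  Cseries v l1 -> Cseries v l2 -> l1 = l2.
Proof.
exact: (@filterlim_locally_unique nat C_AbsRing C_NormedModule eventually _
  (sum_n v) l1 l2).
Qed.

(** The triangle inequality for partial sums, passed to the limit. *)
Lemma Cmod_Cseries_le (v : nat -> C) (w : nat -> R) (l : C) :
  Cseries v l -> (forall n, Cmod (v n) <= w n)%R -> ex_series w ->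
  (Cmod l <= Series w)%R.
Proof.
move=> v_l le_vw w_cv.
have norm_cv : is_lim_seq (fun n => Cmod (sum_n v n)) (Cmod l).
  exact: filterlim_comp _ _ _ v_l (@filterlim_norm _ C_NormedModule l).
have w_lim : is_lim_seq (sum_n w) (Series w) by exact: Series_correct.
apply: (is_lim_seq_le _ _ (Cmod l) (Series w) _ norm_cv w_lim) => n.
apply: (Rle_trans _ _ _ (@norm_sum_n_m _ C_NormedModule _ _ _)).
exact: sum_n_m_le.
Qed.

(** * Termwise differentiation *)

(** Dividing the bound by [|y - x|] shows that the difference quotient is within [M * |y - x|] of
    [l]. *)
Lemma C_derive_quadratic (f : C -> C) (x l : C) (d M : R) :
  (0 < d)%R ->
  (forall y, Cmod (y - x) < d ->
     Cmod (f y - f x - (y - x) * l) <= M * Cmod (y - x) ^ 2)%R ->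
  C_derive f x = l.
Proof.
move=> d_gt0 bound; apply: is_C_lim_unique.
apply/filterlim_locally => eps.
(* Adding 1 makes [K] positive and gives the strict inequality [|M| * (eps / K) < eps] at the
   end. *)
pose K := (1 + Rabs M)%R.
have K_gt0 : (0 < K)%R by move: (Rabs_pos M); rewrite /K; lra.
have s2_gt0 : (0 < sqrt 2)%R by apply: sqrt_lt_R0; lra.
pose e := Rmin d (eps / K)%R.
have e_gt0 : (0 < e)%R.
  by apply: Rmin_pos => //; apply: Rdiv_lt_0_compat => //; apply: cond_pos.
(* Balls of [C] are squares for the product uniformity; the one of half-side [e / sqrt 2] lies in
   the disc of radius [e]. *)
have de_gt0 : (0 < e / sqrt 2)%R by apply: Rdiv_lt_0_compat.
exists (mkposreal _ de_gt0) => y xy y_neq.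
change C in (type of y).
have yx_neq0 : y - x <> 0 by apply: Cminus_eq_contra.
have h_gt0 : (0 < Cmod (y - x))%R by apply/Cmod_gt_0.
have h_lt : (Cmod (y - x) < e)%R.
  have /= := @C_NormedModule_mixin_compat2 x y (mkposreal _ de_gt0) xy.
  by have -> : (sqrt 2 * (e / sqrt 2) = e)%R by field; lra.
apply: C_NormedModule_mixin_compat1.
have -> : minus ((f y - f x) / (y - x)) l
    = (f y - f x - (y - x) * l) / (y - x) :> C.
  by rewrite /minus /plus /opp /=; field.
rewrite Cmod_div //.
apply: (Rmult_lt_reg_r (Cmod (y - x))) => //.
rewrite /Rdiv Rmult_assoc Rinv_l ?Rmult_1_r; last lra.
apply: Rle_lt_trans (bound y _) _.
  exact: Rlt_le_trans h_lt (Rmin_l _ _).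
rewrite /= Rmult_1_r -Rmult_assoc; apply: Rmult_lt_compat_r => //.
apply: (Rle_lt_trans _ (Rabs M * Cmod (y - x))).
  by apply: Rmult_le_compat_r; [lra|apply: Rle_abs].
apply: (Rle_lt_trans _ (Rabs M * (eps / K))).
  apply: Rmult_le_compat_l; first exact: Rabs_pos.
  by apply/Rlt_le/(Rlt_le_trans _ _ _ h_lt)/Rmin_r.
apply: (Rmult_lt_reg_r K) => //.
have -> : (Rabs M * (eps / K) * K = Rabs M * eps)%R by field; lra.
rewrite (Rmult_comm eps); apply: Rmult_lt_compat_r; first exact: cond_pos.
by rewrite /K; lra.
Qed.

(* The factor [r ^ 2] on the left avoids the truncated exponent [n - 2]. *)
Lemma pow_taylor_bound (x y : C) (r : R) (n : nat) :
  (Cmod x <= r)%R -> (Cmod y <= r)%R ->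
  (r ^ 2 * Cmod (y ^ n - x ^ n - (y - x) * (INR n * x ^ n.-1))
   <= INR n ^ 2 * r ^ n * Cmod (y - x) ^ 2)%R.
Proof.
move=> x_le y_le; have x_ge0 := Cmod_ge_0 x; have r_ge0 : (0 <= r)%R by lra.
set h := Cmod (y - x).
elim: n => [|n IH].
  rewrite /= (_ : _ - _ - _ = 0); last by ring.
  by rewrite Cmod_0; lra.
set D := (X in Cmod X) in IH.
have n_ge0 := pos_INR n.
(* Recurrence for the Taylor remainder: multiply the previous one by [y] and correct by
   [n x^(n-1) (y - x)^2]. For [n = 0] the truncated exponent is harmless, since the factor [n]
   vanishes. *)
have -> : y ^ n.+1 - x ^ n.+1 - (y - x) * (INR n.+1 * x ^ n.+1.-1)
    = y * D + INR n * x ^ n.-1 * (y - x) ^ 2.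
  rewrite /D S_INR RtoC_plus; case: n {IH D n_ge0} => [|n] /=; first by ring.
  by ring.
have IH' : (r ^ 2 * Cmod (y * D) <= INR n ^ 2 * r ^ n.+1 * h ^ 2)%R.
  rewrite Cmod_mult.
  apply: (Rle_trans _ (r * (r ^ 2 * Cmod D))).
    rewrite (_ : r ^ 2 * (Cmod y * Cmod D) = Cmod y * (r ^ 2 * Cmod D))%R;
      last by ring.
    apply: Rmult_le_compat_r => //; apply: Rmult_le_pos; first exact: pow_le.
    exact: Cmod_ge_0.
  apply: Rle_trans (Rmult_le_compat_l _ _ _ r_ge0 IH) _.
  by apply: Req_le; rewrite /=; ring.
have tail : (r ^ 2 * Cmod (INR n * x ^ n.-1 * (y - x) ^ 2)
             <= INR n * r ^ n.+1 * h ^ 2)%R.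
  rewrite Cmod_mult Cmod_pow Cmod_mult Cmod_pow Cmod_R.
  rewrite Rabs_pos_eq // -/h.
  case: n {IH D IH'} n_ge0 => [|n] n_ge0; first by rewrite /=; lra.
  rewrite [n.+1.-1]/=.
  have pow_x : (Cmod x ^ n <= r ^ n)%R by apply: pow_incr.
  rewrite (_ : INR n.+1 * r ^ n.+2 * h ^ 2
             = r ^ 2 * (INR n.+1 * r ^ n * h ^ 2))%R; last by rewrite /=; ring.
  apply: Rmult_le_compat_l; first exact: pow_le.
  apply: Rmult_le_compat_r; first exact: pow2_ge_0.
  exact: Rmult_le_compat_l.
have sq_h : (0 <= h ^ 2)%R by exact: pow2_ge_0.
have r2_ge0 : (0 <= r ^ 2)%R by exact: pow2_ge_0.
have rh : (0 <= r ^ n.+1 * h ^ 2)%R by apply: Rmult_le_pos => //; apply: pow_le.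
apply: Rle_trans (Rmult_le_compat_l _ _ _ r2_ge0 (Cmod_triangle _ _)) _.
rewrite Rmult_plus_distr_l S_INR.
apply: Rle_trans (Rplus_le_compat _ _ _ _ IH' tail) _.
(* The slack is [(n + 1) r^(n+1) h^2], because [(n + 1)^2 - (n^2 + n) = n + 1]. *)
have := Rmult_le_pos _ _ (Rplus_le_le_0_compat _ _ n_ge0 Rle_0_1) rh.
nra.
Qed.

(** The bound on the radius is kept beside the sums because differentiation needs absolute
    convergence on a circle beyond the point considered. A fixed [rho] lets the operators be
    iterated on the same disc. *)
Definition sums_on (rho : Rbar) (u : nat -> C) (f : C -> C) : Prop :=
  Rbar_le rho (Cradius u) /\
  forall z, Rbar_lt (Cmod z) rho -> Cseries (fun n => u n * z ^ n) (f z).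

Lemma Rbar_between (x : R) (rho : Rbar) :
  Rbar_lt x rho -> exists2 r : R, (x < r)%R & Rbar_lt r rho.
Proof.
case: rho => [rho| |] //= x_lt; first by exists ((x + rho) / 2)%R; lra.
by exists (x + 1)%R => //; lra.
Qed.

(** Summing the Taylor remainders of the monomials bounds the remainder of [f] quadratically, which
    identifies its derivative with the termwise one. *)
Lemma sums_on_theta (rho : Rbar) (u : nat -> C) (f : C -> C) :
  sums_on rho u f -> sums_on rho (fun n => INR n * u n) (theta f).
Proof.
move=> [le_rho f_sum].
have nu_ext : Cradius (fun n => INR n * u n) = Cradius u.
  rewrite -[RHS]CV_radius_scal_INR; apply: CV_radius_ext => n.
  by rewrite Cmod_mult Cmod_R Rabs_pos_eq //; apply: pos_INR.
split=> [|x x_lt]; first by rewrite nu_ext.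
have [r xr r_rho] := Rbar_between _ _ x_lt.
have x_ge0 := Cmod_ge_0 x; have r_gt0 : (0 < r)%R by lra.
have abs_cv (v : nat -> C) : Cradius v = Cradius u ->
    ex_series (fun n => Cmod (v n) * r ^ n)%R.
  move=> rad_v.
  have /CV_disk_inside : Rbar_lt (Rabs r) (Cradius v).
    by rewrite rad_v Rabs_pos_eq; [apply: Rbar_lt_le_trans le_rho|lra].
  apply: ex_series_ext => n; rewrite Rabs_pos_eq //.
  by apply: Rmult_le_pos; [apply: Cmod_ge_0|apply: pow_le; lra].
have [l l_sum] : exists l, Cseries (fun n => INR n * u n * x ^ n.-1) l.
  apply: (@ex_series_le C_AbsRing C_CompleteNormedModule _
    (fun n => / r * (Cmod (INR n * u n) * r ^ n))%R); last first.
    exact/(@ex_series_scal_l R_AbsRing R_NormedModule)/abs_cv.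
  move=> n; rewrite -[norm _]/(Cmod _) Cmod_mult Cmod_pow.
  case: n => [|n].
    by rewrite Cmult_0_l Cmod_0 /=; apply: Req_le; ring.
  rewrite [n.+1.-1]/= [(r ^ n.+1)%R]/=.
  rewrite (_ : / r * _ = Cmod (INR n.+1 * u n.+1) * r ^ n)%R; last by field; lra.
  apply: Rmult_le_compat_l; first exact: Cmod_ge_0.
  by apply: pow_incr; lra.
suff der_l : C_derive f x = l.
  rewrite /theta der_l.
  apply: is_series_ext (@is_series_scal_l C_AbsRing _ x _ _ l_sum) => -[|n].
    by rewrite /scal /= /mult /=; ring.
  by rewrite /scal /= /mult /=; ring.
(* The majorant [n^2 |u_n| r^n] supplied by [pow_taylor_bound]; it is summable since factors [n]
   preserve the radius. *)
pose w n := (Cmod (INR n * (INR n * u n)) * r ^ n)%R.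
have w_cv : ex_series w.
  apply: abs_cv; rewrite -nu_ext -[RHS]CV_radius_scal_INR.
  apply: CV_radius_ext => n; rewrite !Cmod_mult Cmod_R Rabs_pos_eq //.
  exact: pos_INR.
(* The distance [r - |x|] ensures [|y| <= r]; the divisor [r ^ 2] undoes the factor in
   [pow_taylor_bound]. *)
apply: (@C_derive_quadratic f x l (r - Cmod x) (Series w / r ^ 2)%R).
  lra.
move=> y y_near.
have y_le : (Cmod y <= r)%R.
  have := Cmod_triangle (y - x) x.
  by rewrite (_ : y - x + x = y); [lra|ring].
have fy : Cseries (fun n => u n * y ^ n) (f y).
  by apply: f_sum; apply: Rbar_le_lt_trans r_rho.
have fx := f_sum x x_lt.
set h := (y - x).
pose v n := u n * (y ^ n - x ^ n - h * (INR n * x ^ n.-1)).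
have v_sum : Cseries v (f y - f x - h * l).
  have := is_series_minus _ _ _ _ (is_series_minus _ _ _ _ fy fx)
    (@is_series_scal_l C_AbsRing _ h _ _ l_sum).
  apply: is_series_ext => n.
  by rewrite /v /plus /opp /scal /= /mult /=; ring.
have w'_cv := @ex_series_scal_l R_AbsRing R_NormedModule
  (Cmod h ^ 2 / r ^ 2)%R w w_cv.
have := Cmod_Cseries_le v _ _ v_sum _ w'_cv.
rewrite Series_scal_l.
rewrite (_ : Series w / r ^ 2 * Cmod h ^ 2
           = Cmod h ^ 2 / r ^ 2 * Series w)%R; last by rewrite /Rdiv; ring.
apply=> n; rewrite /v /w /scal /= /mult /= !Cmod_mult.
have r2_gt0 : (0 < r ^ 2)%R by apply: pow_lt.
have := @pow_taylor_bound x y r n (Rlt_le _ _ xr) y_le.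
rewrite -/h; set D := Cmod (y ^ n - _ - _) => D_le.
apply: (Rmult_le_reg_l (r ^ 2)) => //.
rewrite Cmod_R (Rabs_pos_eq (INR n)); last exact: pos_INR.
rewrite (_ : r ^ 2 * (Cmod (u n) * D) = Cmod (u n) * (r ^ 2 * D))%R;
  last by ring.
apply: Rle_trans (Rmult_le_compat_l _ _ _ (Cmod_ge_0 _) D_le) _.
by apply: Req_le; rewrite /=; field; lra.
Qed.

(** * Shifted Euler operators and their products on power series *)

Lemma sums_on_theta_plus (rho : Rbar) (u : nat -> C) (f : C -> C) (c : C) :
  sums_on rho u f -> sums_on rho (fun n => (INR n + c) * u n) (theta_plus c f).
Proof.
move=> f_sum; have [_ tf_sum] := sums_on_theta _ _ _ f_sum.
case: f_sum => le_rho f_sum.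
split=> [|x x_lt]; first exact: Rbar_le_trans le_rho (Cradius_scal_shift _ _).
have := is_series_plus _ _ _ _ (tf_sum x x_lt)
  (@is_series_scal_l C_AbsRing _ c _ _ (f_sum x x_lt)).
apply: is_series_ext => n.
by rewrite /plus /scal /= /mult /=; ring.
Qed.

Lemma sums_on_theta_prod (rho : Rbar) (u : nat -> C) (f : C -> C)
    (n : nat) (c : 'I_n -> C) :
  sums_on rho u f ->
  sums_on rho (fun m => (\Cprod_(i < n) (INR m + c i)) * u m)
    (theta_prod c f).
Proof.
move=> f_sum; rewrite /theta_prod; elim: n c => [|n IH] c.
  rewrite big_ord0; case: f_sum => le_rho f_sum.
  split=> [|z z_lt].
    rewrite /Cradius (CV_radius_ext _ (fun m => Cmod (u m))) // => m.
    by rewrite big_ord0 Cmult_1_l.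
  apply: is_series_ext (f_sum z z_lt) => m.
  by rewrite big_ord0 Cmult_1_l.
rewrite big_ord_recl /=.
have [le_rho sum] :=
  sums_on_theta_plus _ _ _ (c ord0) (IH (fun i => c (lift ord0 i))).
split=> [|z z_lt].
  apply: Rbar_le_trans le_rho _; apply: CV_radius_le => m.
  by rewrite big_ord_recl Cmult_assoc; apply: Rle_refl.
by apply: is_series_ext (sum z z_lt) => m; rewrite big_ord_recl Cmult_assoc.
Qed.

(** * The hypergeometric series *)

Lemma pow_n_Cpow (x : C) (n : nat) : @pow_n C_Ring x n = x ^ n.
Proof. by elim: n => //= n ->. Qed.

(** Absolute convergence inside the disc gives a sum, and uniqueness of limits makes [iota] select
    it. *)
Lemma pk_hypergeometric_sums (r q : nat) (a : 'I_r -> C) (p k : 'I_r -> R)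
    (b : 'I_q -> C) (t s : 'I_q -> R) :
  sums_on (Cradius (pk_coef a p k b t s)) (pk_coef a p k b t s)
    (pk_hypergeometric a p k b t s).
Proof.
set u := pk_coef a p k b t s; split=> [|z z_lt]; first exact: Rbar_le_refl.
have [l l_sum] : exists l, Cseries (fun n => u n * z ^ n) l.
  apply: (@ex_series_le C_AbsRing C_CompleteNormedModule _
    (fun n => Rabs (Cmod (u n) * Cmod z ^ n))); last first.
    by apply: CV_disk_inside; rewrite Rabs_pos_eq //; apply: Cmod_ge_0.
  move=> n; rewrite -[norm _]/(Cmod _) Cmod_mult Cmod_pow.
  exact: Rle_abs.
have l_ps : @is_pseries C_AbsRing C_NormedModule u z l.
  apply: is_series_ext l_sum => n.
  by rewrite pow_n_Cpow /scal /= /mult /= Cmult_comm.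
rewrite /pk_hypergeometric (@iota_unique _ C_CompleteNormedModule _ l) //.
by move=> l' l'_ps; apply: Cseries_unique l'_ps l_ps.
Qed.

Lemma pk_pochhammerS (p k : R) (z : C) (n : nat) : (0 < k)%R ->
  pk_pochhammer p k z n.+1 = pk_pochhammer p k z n * (p * (INR n + z / k)).
Proof.
move=> k_gt0; rewrite /pk_pochhammer big_ord_recr /=; congr (_ * _).
by field; move=> /RtoC_inj; lra.
Qed.

Lemma pk_pochhammer_neq0 (p k : R) (z : C) (n : nat) :
  (0 < k)%R -> (0 < p)%R -> (forall m : nat, z / k <> - INR m) ->
  pk_pochhammer p k z n <> 0.
Proof.
move=> k_gt0 p_gt0 z_nonpole; apply: Cprod_neq0 => m.
have k_neq0 : RtoC k <> 0 by move=> /RtoC_inj; lra.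
have -> : z * p / k + INR m * p = p * (z / k + INR m) by field.
apply: Cmult_neq_0; first by move=> /RtoC_inj; lra.
move=> zm0; apply: (z_nonpole m).
by rewrite (_ : z / k = z / k + INR m - INR m); [rewrite zm0|]; ring.
Qed.

(** Each Pochhammer symbol gains one factor from [n] to [n + 1]. The scales [p i] and [t j] collect
    into the constant, while [n + 1] and the factors [n + b j / s j] cancel against the new
    denominators. *)
Lemma pk_coef_rec (r q : nat) (a : 'I_r -> C) (k p : 'I_r -> R)
    (s t : 'I_q -> R) (b : 'I_q -> C) (n : nat) :
  (forall i, (0 < k i)%R) -> (forall j, (0 < s j)%R) ->
  (forall j, (0 < t j)%R) ->
  (forall (j : 'I_q) (m : nat), b j / s j <> - INR m) ->
  INR n.+1 * ((\Cprod_(j < q) (INR n + b j / s j)) * pk_coef a p k b t s n.+1)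
  = (\Cprod_(i < r) p i) / (\Cprod_(j < q) t j) *
    ((\Cprod_(i < r) (INR n + a i / k i)) * pk_coef a p k b t s n).
Proof.
move=> k_gt0 s_gt0 t_gt0 b_nonpole; rewrite /pk_coef.
have -> : \Cprod_(i < r) pk_pochhammer (p i) (k i) (a i) n.+1
    = (\Cprod_(i < r) pk_pochhammer (p i) (k i) (a i) n)
      * ((\Cprod_(i < r) p i) * \Cprod_(i < r) (INR n + a i / k i)).
  by rewrite -!big_split; apply: eq_bigr => i _; rewrite pk_pochhammerS.
have -> : \Cprod_(j < q) pk_pochhammer (t j) (s j) (b j) n.+1
    = (\Cprod_(j < q) pk_pochhammer (t j) (s j) (b j) n)
      * ((\Cprod_(j < q) t j) * \Cprod_(j < q) (INR n + b j / s j)).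
  by rewrite -!big_split; apply: eq_bigr => j _; rewrite pk_pochhammerS.
rewrite factS mult_INR RtoC_mult.
have fact_neq0 : RtoC (INR n`!) <> 0.
  by move=> /RtoC_inj/(INR_eq _ 0) n0; have := fact_gt0 n; rewrite n0.
have n_neq0 : RtoC (INR n.+1) <> 0 by move=> /RtoC_inj/(INR_eq _ 0).
have t_neq0 : \Cprod_(j < q) t j <> 0.
  by apply: Cprod_neq0 => j /RtoC_inj; have := t_gt0 j; lra.
have poch_neq0 : \Cprod_(j < q) pk_pochhammer (t j) (s j) (b j) n <> 0.
  by apply: Cprod_neq0 => j; apply: pk_pochhammer_neq0.
have b_neq0 : \Cprod_(j < q) (INR n + b j / s j) <> 0.
  apply: Cprod_neq0 => j nb0; apply: (b_nonpole j n).
  by rewrite (_ : b j / s j = INR n + b j / s j - INR n); [rewrite nb0|]; ring.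
by field.
Qed.

Theorem theorem4p2 (r q : nat) (hrq : (r <= q + 1)%nat)
  (a : 'I_r -> C) (k p : 'I_r -> R) (s t : 'I_q -> R) (b : 'I_q -> C)
  (hk : forall i, (0 < k i)%R) (hp : forall i, (0 < p i)%R)
  (hs : forall j, (0 < s j)%R) (ht : forall j, (0 < t j)%R)
  (hb : forall (j : 'I_q) (m : nat), b j / s j <> - INR m)
  (hbb : forall (i j : 'I_q) (m : Z), i <> j ->
     b i / s i - b j / s j <> IZR m) :
  let A : C := (\Cprod_(i < r) p i) / (\Cprod_(j < q) t j) in
  let W : C -> C := pk_hypergeometric a p k b t s in
  forall x : C, pk_disc a p k b t s x ->
    theta (theta_prod (fun j : 'I_q => b j / s j - 1) W) x
    - A * x * theta_prod (fun i : 'I_r => a i / k i) W x = 0.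
Proof.
move=> A W x x_disc.
have W_sum := pk_hypergeometric_sums r q a p k b t s.
have [_ lhs_sum] := sums_on_theta _ _ _
  (sums_on_theta_prod _ _ _ q (fun j => b j / s j - 1) W_sum).
have [_ rhs_sum] := sums_on_theta_prod _ _ _ r (fun i => a i / k i) W_sum.
rewrite -/W in lhs_sum rhs_sum.
have := @is_series_scal_l C_AbsRing _ (A * x) _ _ (rhs_sum x x_disc).
set L := theta _ _; set Q := theta_prod _ _ _ => rhs.
suff -> : L = A * x * Q by ring.
apply: Cseries_unique (lhs_sum x x_disc) _.
(* The outer [theta] kills the constant term, so the left series can start at index 1 and be matched
   with the one shifted by [x]. *)
apply: is_series_decr_1.
rewrite (_ : plus _ _ = A * x * Q); last first.
  by rewrite /plus /opp /=; ring.
apply: is_series_ext rhs => n.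
(* At index [n + 1] the shift absorbs the [- 1]: [(n + 1) + (b j / s j - 1) = n + b j / s j]. *)
rewrite (eq_bigr (fun j => INR n + b j / s j)); last first.
  by move=> j _; rewrite S_INR RtoC_plus; ring.
by rewrite pk_coef_rec // Cpow_S -/A /scal /= /mult /=; ring.
Qed.
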